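(* For every $\varepsilon>0$ there exist a tree and an initial placement of tokens on it such that every execution of the Happy Swap algorithm and every execution of the Cycle algorithm on this instance performs more than $(2-\varepsilon)\cdot\mathrm{OPT}$ swaps, where $\mathrm{OPT}$ is the minimum number of swaps needed to sort the tokens. Hence neither algorithm has approximation factor less than $2$.
   Context: Token swapping on a tree: vertices $v_1,\dots,v_n$, tokens $1,\dots,n$, one per vertex; a swap exchanges the tokens on the endpoints of an edge; the goal is to get token $i$ to $v_i$ for all $i$ (sorting). A token is home if it is on its destination. For a token $i$ at its current vertex, $p(i)$ denotes the unique tree path from its current vertex to its destination $v_i$. Happy Swap algorithm: starting from the initial placement, as long as the tokens are not sorted, repeatedly perform one of the following operations on some edge $(u,v)$ with token $i$ on $u$ and token $j$ on $v$: a happy swap, which exchanges $i$ and $j$ when $p(i)$ contains $v$ and $p(j)$ contains $u$; or a shove, which exchanges $i$ and $j$ when $p(i)$ contains $v$ and $j$ is home. (The choice among applicable operations is arbitrary.) Cycle algorithm: consider the permutation of tokens in which the successor of token $t$ is the token initially on $t$'s destination; process its cycles one at a time, in arbitrary order. For a cycle written $(t_1\,t_2\cdots t_q)$ (starting token arbitrary), where for $i<q$ token $t_{i+1}$ initially occupies the destination of $t_i$: for $i=1,\dots,q-1$, swap token $t_i$ along the tree path from its current vertex toward the vertex currently containing $t_{i+1}$, stopping one vertex short of it; finally swap $t_q$ along the path from its current vertex to its destination. *)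

(* Defs.v *)
From mathcomp Require Import all_boot all_order all_algebra all_fingroup.
From mathcomp Require Import reals.

Set Implicit Arguments.
Unset Strict Implicit.
Unset Printing Implicit Defensive.

Import Order.TTheory GRing.Theory Num.Theory.

Section TokenSwapping.

Variables (V : finType) (e : rel V).

Definition is_tree : Prop :=
  [/\ 0 < #|V|, symmetric e, irreflexive e,
      forall x y, connect e x y
    & forall c : seq V, ucycle e c -> size c <= 2].

(* As in path.v, a path starting at x is given by the sequence p of its
   vertices other than x. *)
Definition tree_path (x y : V) (p : seq V) : Prop :=
  [/\ path e x p, uniq (x :: p) & last x p = y].

(* Tokens are named by their destination vertices; a placement maps each
   vertex to the token it carries. *)
Implicit Type f : {perm V}.

Definition pos f (t : V) : V := (f^-1)%g t.

Definition home f (t : V) : Prop := pos f t = t.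

Definition sorted_placement f : Prop := forall t, home f t.

Definition swap f (u v : V) : {perm V} := (tperm u v * f)%g.

Definition route_contains f (t v : V) : Prop :=
  exists2 p, tree_path (pos f t) t p & v \in pos f t :: p.

Inductive sortable_in : {perm V} -> nat -> Prop :=
| Sortable0 f : sorted_placement f -> sortable_in f 0
| SortableS f u v k :
    e u v -> sortable_in (swap f u v) k -> sortable_in f k.+1.

Definition is_OPT f (k : nat) : Prop :=
  sortable_in f k /\ forall m, sortable_in f m -> k <= m.

Definition happy_swap f (u v : V) : Prop :=
  [/\ e u v, route_contains f (f u) v & route_contains f (f v) u].

Definition shove f (u v : V) : Prop :=
  [/\ e u v, route_contains f (f u) v & home f (f v)].

(* happy_swap_exec f k: some complete execution from f performs k swaps. *)
Inductive happy_swap_exec : {perm V} -> nat -> Prop :=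
| HappyDone f : sorted_placement f -> happy_swap_exec f 0
| HappyStep f u v k :
    ~ sorted_placement f -> happy_swap f u v \/ shove f u v ->
    happy_swap_exec (swap f u v) k -> happy_swap_exec f k.+1.

(* Moves the token on x along the path x :: p, using size p swaps. *)
Fixpoint move_along f (x : V) (p : seq V) : {perm V} :=
  if p is y :: p' then move_along (swap f x y) y p' else f.

(* process_cycle f c g k: processing the cycle c, starting from its first
   token, leads from f to g in k swaps. In ProcessStep the full path ends at
   the vertex of t', and p omits that vertex. *)
Inductive process_cycle : {perm V} -> seq V -> {perm V} -> nat -> Prop :=
| ProcessLast f t p :
    tree_path (pos f t) t p ->
    process_cycle f [:: t] (move_along f (pos f t) p) (size p)
| ProcessStep f t t' s p g k :
    tree_path (pos f t) (pos f t') (rcons p (pos f t')) ->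
    process_cycle (move_along f (pos f t) p) (t' :: s) g k ->
    process_cycle f [:: t, t' & s] g (size p + k).

Inductive process_cycles :
  {perm V} -> seq (seq V) -> {perm V} -> nat -> Prop :=
| ProcessNil f : process_cycles f [::] f 0
| ProcessCons f c cs g h k l :
    process_cycle f c g k -> process_cycles g cs h l ->
    process_cycles f (c :: cs) h (k + l).

(* As tokens are named by their destinations, the successor of t, i.e. the
   token initially on the destination of t, is f t. *)
Definition cycle_listing f (cs : seq (seq V)) : Prop :=
  [/\ [::] \notin cs, all (fcycle f) cs & perm_eq (flatten cs) (enum V)].

Definition cycle_exec f (k : nat) : Prop :=
  exists cs g, cycle_listing f cs /\ process_cycles f cs g k.

End TokenSwapping.

(* An algorithm is given by the swap counts of its executions. *)
Definition algorithm : Type :=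
  forall V : finType, rel V -> {perm V} -> nat -> Prop.

Definition approximation_factor (R : realType) (A : algorithm) (c : R) : Prop :=
  forall (V : finType) (e : rel V) (f : {perm V}) (opt k : nat),
    is_tree e -> is_OPT e f opt -> A V e f k -> (k%:R <= c * opt%:R)%R.

(* Main.v *)
Require Import Defs.
From mathcomp Require Import all_boot all_order all_algebra all_fingroup.
From mathcomp Require Import reals boolp zify lra.

Set Implicit Arguments.
Unset Strict Implicit.
Unset Printing Implicit Defensive.

Import Order.TTheory GRing.Theory Num.Theory.

(** The tree is a double broom: a handle of N + 1 vertices with K + 1 leaves
    attached to each of its two ends. The handle tokens are home, and every leaf
    token must travel to a leaf at the other end, so the total distance is about
    2KN.

    Once the handle is filled with tokens heading right, moving a token from a
    right leaf along the handle to a left leaf advances all of them by one step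
    and delivers one of them; every swap then brings both tokens closer to their
    destinations. The optimum is therefore at most KN up to lower order terms for
    K much larger than N.

    In the Happy Swap algorithm a token that starts home is never farther than one
    step from its home. At most two handle tokens can thus be off the handle, and
    at most two leaf tokens on it. A swap of two leaf tokens inside the handle
    leaves no two leaf tokens facing each other there, and only a swap at a leaf
    can create a new facing pair, so the saving of one step that such a swap
    brings is paid for and the algorithm spends one swap per step of a leaf token.

    The Cycle algorithm moves each leaf token along the handle on its own, since
    the tokens on the other leaves stay in place. *)

(** * Placements and swaps as permutations *)

Section Placements.

Variables (V : finType) (e : rel V).
Implicit Types (f g : {perm V}) (u v w t : V).

Lemma swapE f u v w : swap f u v w = f (tperm u v w).
Proof. by rewrite permM. Qed.

Lemma swapC f u v : swap f u v = swap f v u.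
Proof. by rewrite /swap tpermC. Qed.

Lemma posK f t : f (pos f t) = t.
Proof. exact: permKV. Qed.

Lemma pos_perm f w : pos f (f w) = w.
Proof. exact: permK. Qed.

Lemma pos_swap f u v t : pos (swap f u v) t = tperm u v (pos f t).
Proof. by rewrite /pos invMg permM tpermV. Qed.

Lemma sorted_placementP f : sorted_placement f <-> f = 1%g.
Proof.
split=> [fh|-> t]; last by rewrite /home /pos invg1 perm1.
by apply/permP=> t; rewrite perm1 -{1}(fh t) posK.
Qed.

Lemma sum_swap (G : V -> V -> nat) f u v : u != v ->
  (\sum_w G w (swap f u v w) + (G u (f u) + G v (f v)) =
   \sum_w G w (f w) + (G u (f v) + G v (f u)))%N.
Proof.
move=> uv; rewrite (bigD1 u) //= (bigD1 v) /=; last by rewrite eq_sym.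
rewrite [in RHS](bigD1 u) //= [in RHS](bigD1 v) /=; last by rewrite eq_sym.
rewrite !swapE tpermL tpermR.
rewrite (eq_bigr (fun w => G w (f w))); first by lia.
by move=> w /andP[wu wv]; rewrite swapE tpermD // eq_sym.
Qed.

(** * Number of swaps needed to sort a placement *)

(** Swaps multiply a placement on the left, so the swaps that sort [f] turn [f * g] into [g]. *)
Lemma sortableM f g m n :
  sortable_in e f m -> sortable_in e g n -> sortable_in e (f * g)%g (m + n).
Proof.
move=> sf sg; elim: sf => {f m} [f /sorted_placementP ->|f u v m euv _ IH].
  by rewrite mul1g.
by apply: (SortableS euv); rewrite /swap mulgA.
Qed.

Lemma sortable1 : sortable_in e 1%g 0.
Proof. by apply: Sortable0; apply/sorted_placementP. Qed.

Lemma sortable_tperm u v : e u v -> sortable_in e (tperm u v) 1.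
Proof. by move/SortableS; apply; rewrite /swap tperm2; apply: sortable1. Qed.

(** Conjugation by the first edge costs two more swaps. The path need not be simple, hence the cases
    where it ends at [u] or [y]. *)
Lemma sortable_tperm_path u p : path e u p ->
  exists2 m, m <= 2 * size p & sortable_in e (tperm u (last u p)) m.
Proof.
elim: p u => [|y p IH] u /=; first by exists 0 => //; rewrite tperm1; apply: sortable1.
case/andP=> uy /IH[m le_m sm]; set z := last y p in sm *.
have [->|zu] := eqVneq z u; first by exists 0 => //; rewrite tperm1; apply: sortable1.
have [->|zy] := eqVneq z y; first by exists 1; [lia | apply: sortable_tperm].
exists (1 + (m + 1)); first by lia.
have -> : tperm u z = (tperm u y * (tperm y z * tperm u y))%g.
  by rewrite -{1}(tpermV u y) -[RHS]/(conjg _ _) tpermJ tpermR tpermD // eq_sym.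
by do 2?apply: sortableM => //; apply: sortable_tperm.
Qed.

(* g is turned into f by one transposition for each vertex where they differ. *)
Lemma sortable_patch C f g n s :
    (forall u v, exists2 m, m <= C & sortable_in e (tperm u v) m) ->
    #|[set w | f w != g w]| <= s -> sortable_in e g n ->
  exists2 m, m <= n + s * C & sortable_in e f m.
Proof.
move=> hC; elim: s g n => [|s IH] g n.
  rewrite leqn0 cards_eq0 => /eqP D0 sg; exists n; first by lia.
  suff -> : f = g by [].
  apply/permP=> w; apply/eqP; have: w \notin [set w | f w != g w] by rewrite D0 inE.
  by rewrite inE negbK.
have [|[p pD]] := set_0Vmem [set w | f w != g w].
  move=> D0 _ sg; have [|m le_m sm] := IH g n _ sg; first by rewrite D0 cards0.
  by exists m => //; apply: leq_trans le_m _; rewrite mulSn; lia.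
rewrite (cardsD1 p) pD ltnS => le_s sg; set q := pos g (f p).
have [c le_c sc] := hC p q.
have [||m le_m sm] := IH (swap g p q) (c + n); last 1 first.
- by exists m => //; apply: leq_trans le_m _; rewrite mulSn; lia.
- apply: leq_trans le_s; apply: subset_leq_card; apply/subsetP=> w.
  rewrite !inE swapE => fw; have wp : w != p.
    by apply: contraNneq fw => ->; rewrite tpermL posK.
  rewrite wp /=; have [wq|wq] := eqVneq w q; last first.
    by move: fw; rewrite tpermD // eq_sym.
  apply: contraNneq wp => E; apply/eqP/(@perm_inj _ f).
  by rewrite E wq /q posK.
- exact: sortableM.
Qed.

Lemma is_OPT_exists f m : sortable_in e f m -> exists2 k, k <= m & is_OPT e f k.
Proof.
move=> sm; have ex : exists n, `[< sortable_in e f n >] by exists m; apply/asboolP.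
case: (ex_minnP ex) => k /asboolP sk mink; exists k.
  by apply: mink; apply/asboolP.
by split=> // n sn; apply: mink; apply/asboolP.
Qed.

(** The cycle [c 0 -> c 1 -> ... -> c m -> c 0], written with m swaps of consecutive points. *)
Fixpoint rotation (c : nat -> V) m : {perm V} :=
  if m is m'.+1 then swap (rotation c m') (c m') (c m) else 1%g.

Lemma sortable_rotation c m : (forall i, i < m -> e (c i) (c i.+1)) ->
  sortable_in e (rotation c m) m.
Proof.
elim: m => [|m IH] ec; first exact: sortable1.
apply: (SortableS (ec m (ltnSn m))); rewrite /= /swap mulgA tperm2 mul1g.
by apply: IH => i im; apply: ec; lia.
Qed.

Lemma rotation_out c m w : (forall i, i <= m -> c i != w) -> rotation c m w = w.
Proof.
elim: m => [|m IH] cw /=; first by rewrite perm1.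
by rewrite swapE tpermD ?cw // IH // => i im; rewrite cw // ltnW.
Qed.

Lemma rotation_in c m : {in [pred i | i <= m] &, injective c} ->
  (forall i, i < m -> rotation c m (c i) = c i.+1) /\ rotation c m (c m) = c 0.
Proof.
elim: m => [|m IH] cI /=; first by rewrite perm1.
have [|IH1 IH2] := IH.
  by move=> i j im jm; apply: cI; rewrite inE ltnW.
have neq i j : i <= m.+1 -> j <= m.+1 -> i != j -> c i != c j.
  by move=> im jm; apply: contraNneq => /cI ->.
split=> [i|]; last by rewrite swapE tpermR.
rewrite ltnS leq_eqVlt => /orP[/eqP->|im]; rewrite swapE.
  by rewrite tpermL rotation_out // => j jm; apply: neq => //; lia.
by rewrite tpermD ?IH1 // neq //; lia.
Qed.

(** * Trees *)

(** A vertex of largest rank on a cycle has both its cycle neighbours below it, so they coincide. *)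
Lemma acyclic_rank (rk : V -> nat) :
    (forall u v, e u v -> rk u != rk v) -> symmetric e ->
    (forall w u v, e w u -> e w v -> rk u < rk w -> rk v < rk w -> u = v) ->
  forall c, ucycle e c -> size c <= 2.
Proof.
move=> rk_edge e_sym rk_low c /andP[c_cyc c_uniq].
case: c c_cyc c_uniq => [//|x0 c0]; move: (x0 :: c0) (mem_head x0 c0) => c x0c cc uc.
have [u uc_in u_max] : exists2 u, u \in c & forall w, w \in c -> rk w <= rk u.
  by case: (arg_maxnP (P := mem c) rk x0c) => u uc' um; exists u.
have [i s def_c] := rot_to uc_in.
rewrite -(size_rot i) def_c; rewrite -(rot_cycle i) def_c in cc.
rewrite -(rot_uniq i) def_c in uc.
have {}u_max w : w \in s -> rk w <= rk u.
  by move=> ws; apply: u_max; rewrite -(mem_rot i) def_c inE ws orbT.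
case: s {def_c} cc uc u_max => [//|v s] /= /andP[uv].
rewrite rcons_path => /andP[_ vu] /and3P[_ vs _] u_max.
case: s vs vu u_max => [//|y s] vs /= vu u_max.
have low w : w \in [:: v, y & s] -> e u w -> rk w < rk u.
  by move=> ws uw; rewrite ltn_neqAle u_max // eq_sym rk_edge.
have ul : e u (last y s) by rewrite e_sym.
have lI : last y s \in y :: s by apply: mem_last.
have E := rk_low _ _ _ uv ul (low _ (mem_head _ _) uv) (low _ _ ul).
by rewrite E ?lI // inE lI orbT in vs.
Qed.

Definition leaf w := forall a b, e w a -> e w b -> a = b.

Lemma leaf_end_of_path u v p w : symmetric e -> leaf w -> tree_path e u v p ->
  w \in u :: p -> w = u \/ w = v.
Proof.
move=> e_sym wl [pp up <-]; rewrite inE => /predU1P[->|wp]; first by left.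
right; case/splitPr: p / wp pp up => p1 p2.
rewrite cat_path last_cat /= => /and3P[_ lw wp2] /andP[up].
case: p2 wp2 up => [//|y p2] /= /andP[wy _] up uq.
have E : last u p1 = y by apply: wl; rewrite // e_sym.
have: y \in u :: p1 by rewrite -E mem_last.
rewrite inE => /predU1P[yu|yp1].
  by rewrite mem_cat !inE yu eqxx !orbT in up.
by move: uq; rewrite cat_uniq => /and3P[_ /hasPn/(_ y)]; rewrite !inE eqxx orbT yp1 => /(_ isT).
Qed.

Hypothesis e_tree : is_tree e.

Lemma edge_neq u v : e u v -> u != v.
Proof. by case: e_tree => _ _ e_irr _ _; apply: contraTneq => ->; rewrite e_irr. Qed.

Lemma tree_path_refl u p : tree_path e u u p -> p = [::].
Proof.
case=> _ /= /andP[up _]; case: p up => [//|x p] up /= E.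
by case/negP: up; rewrite -{1}E mem_last.
Qed.

Lemma tree_path_edge u v p : e u v -> tree_path e u v p -> p = [:: v].
Proof.
move=> uv [pp up lp]; have [_ e_sym _ _ e_cyc] := e_tree.
have /e_cyc : ucycle e (u :: p) by rewrite /ucycle up andbT /= rcons_path pp lp e_sym.
case: p pp up lp => [|x [|y p]] //= _ _ E; last by rewrite E.
by move: (edge_neq uv); rewrite -E eqxx.
Qed.

Lemma tree_path_exists u v : exists p, tree_path e u v p.
Proof.
case: e_tree => _ _ _ conn _; case/connectP: (conn u v) => p pp ->.
by case: (shortenP pp) => q pq uq _; exists q.
Qed.

(** * Cycle algorithm *)

Lemma move_along_out f x p w : w \notin x :: p -> move_along f x p w = f w.
Proof.
elim: p f x => [//|y p IH] f x; rewrite inE negb_or => /andP[wx wp] /=.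
rewrite IH // swapE tpermD 1?eq_sym //.
by move: wp; rewrite inE negb_or => /andP[].
Qed.

(** A leaf on a tree path is one of its ends, and here every end carries a token of the cycle or is
    the destination of one. *)
Lemma process_cycle_leaf f c g k w : process_cycle e f c g k ->
  leaf w -> w \notin c -> f w \notin c -> g w = f w.
Proof.
have [_ e_sym _ _ _] := e_tree.
elim=> {f c g k} [f t p tp|f t t' s p g k tp _ IH] wl.
  rewrite !inE => wt fwt; apply: move_along_out; apply/negP.
  case/(leaf_end_of_path e_sym wl tp) => E; last by rewrite E eqxx in wt.
  by rewrite E posK eqxx in fwt.
move=> wc fwc.
have wp : w \notin pos f t :: p.
  have pq : {subset pos f t :: p <= pos f t :: rcons p (pos f t')}.
    by move=> x; rewrite !inE mem_rcons inE => /orP[]->; rewrite ?orbT.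
  apply/negP=> /pq/(leaf_end_of_path e_sym wl tp)[E|E].
    by rewrite E posK mem_head in fwc.
  by rewrite E posK !inE eqxx orbT in fwc.
have fw : move_along f (pos f t) p w = f w by apply: move_along_out.
rewrite -fw; apply: IH => //; rewrite ?fw; [move: wc | move: fwc];
  by rewrite inE negb_or => /andP[].
Qed.

Lemma process_cycle_exists f c : c != [::] -> uniq c ->
  exists g k, process_cycle e f c g k.
Proof.
case: c => [//|t s] _; elim: s t f => [|t' s IH] t f.
  move=> _; have [p tp] := tree_path_exists (pos f t) t.
  by do 2 eexists; apply: ProcessLast tp.
case/andP=> tt' us; have [p tp] := tree_path_exists (pos f t) (pos f t').
case/lastP: p tp => [[_ _ /= /perm_inj E]|p z tp].
  by rewrite E mem_head in tt'.
have E : z = pos f t' by case: tp => _ _; rewrite last_rcons.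
rewrite E in tp; have [g [k gk]] := IH t' (move_along f (pos f t) p) us.
by exists g, (size p + k); apply: ProcessStep tp gk.
Qed.

(** Refuting an approximation factor takes an actual execution; the orbits of [f] serve as its
    cycles. *)
Lemma cycle_exec_exists f : exists k, cycle_exec e f k.
Proof.
pose cs := [seq fingraph.orbit f y | y <- enum (froots f)].
have count_cs x : count_mem x (flatten cs) = 1.
  rewrite count_flatten -map_comp sumnE big_map big_enum_cond /=.
  have fI : injective f by apply: perm_inj.
  rewrite (bigD1 (froot f x)) /=; last first.
    by rewrite andbT; apply: roots_root; apply: fconnect_sym.
  rewrite count_uniq_mem ?orbit_uniq // -fconnect_orbit fconnect_sym //.
  rewrite connect_root big1 // => y /andP[/andP[yr _] yx].
  have ry : froot f y = y by apply/eqP.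
  rewrite count_uniq_mem ?orbit_uniq // -fconnect_orbit; apply/eqP; rewrite eqb0.
  apply: contra yx => yx; rewrite -ry; apply/eqP.
  by apply/(fingraph.rootP (fconnect_sym fI)).
have csP : perm_eq (flatten cs) (enum V).
  by apply/allP=> x _ /=; rewrite count_cs count_uniq_mem ?enum_uniq // mem_enum.
have orb0 y : fingraph.orbit f y != [::].
  by rewrite -size_eq0 size_orbit -lt0n fingraph.order_gt0.
have listing : cycle_listing f cs.
  split=> //; first by apply/mapP=> -[y _ E]; have := orb0 y; rewrite -E.
  by apply/allP=> _ /mapP[y _ ->]; apply: cycle_orbit; apply: perm_inj.
have proc s h : exists g k, process_cycles e h [seq fingraph.orbit f y | y <- s] g k.
  elim: s h => [|y s IH] h /=; first by exists h, 0; apply: ProcessNil.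
  have [g [k gk]] := process_cycle_exists h (orb0 y) (orbit_uniq f y).
  by have [g' [l gl]] := IH g; exists g', (k + l); apply: ProcessCons gk gl.
by have [g [k gk]] := proc (enum (froots f)) f; exists k, cs, g.
Qed.

(** * Happy Swap algorithm *)

Definition near_home f t := home f t \/ e (pos f t) t.

Lemma route_near_home f u v : e u v -> route_contains e f (f u) v ->
  near_home f (f u) -> v = f u.
Proof.
move=> uv [p]; rewrite /near_home /home pos_perm => tp vp [E|E].
  rewrite -E in tp; move: vp; rewrite (tree_path_refl tp) inE => /eqP vu.
  by move: (edge_neq uv); rewrite vu eqxx.
move: vp; rewrite (tree_path_edge E tp) !inE => /orP[] /eqP // vu.
by move: (edge_neq uv); rewrite vu eqxx.
Qed.

(* Only a shove moves a token away from its destination, and that token is home. *)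
Lemma near_home_step f u v t : happy_swap e f u v \/ shove e f u v ->
  near_home f t -> near_home (swap f u v) t.
Proof.
have [_ e_sym _ _ _] := e_tree.
have [fut|fut] := eqVneq (f u) t; last have [fvt|fvt] := eqVneq (f v) t.
- have tu : pos f t = u by rewrite -fut pos_perm.
  case=> -[uv rc _]; rewrite -fut => /(route_near_home uv rc) E; left;
    by rewrite /home pos_swap pos_perm tpermL.
- have tv : pos f t = v by rewrite -fvt pos_perm.
  case=> -[uv _ rc]; rewrite -fvt.
    rewrite e_sym in uv; move/(route_near_home uv rc) => E; left.
    by rewrite /home pos_swap pos_perm tpermR.
  by move: rc; rewrite /home /near_home pos_swap pos_perm tpermR => <- _; right.
- rewrite /near_home /home !pos_swap tpermD //.
  + by apply: contraNneq fut => ->; rewrite posK.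
  + by apply: contraNneq fvt => ->; rewrite posK.
Qed.

End Placements.

(** * Existence of a complete Happy Swap execution *)

Section HappySwapTermination.

Variables (V : finType) (e : rel V).
Hypothesis e_tree : is_tree e.
Implicit Types (f g : {perm V}) (u v w t : V).

Lemma walk_exists u w :
  exists n, [exists p : n.-tuple V, path e u p && (last u p == w)].
Proof.
have [p [pp _ lp]] := tree_path_exists e_tree u w.
by exists (size p); apply/existsP; exists (in_tuple p); rewrite pp lp eqxx.
Qed.

Definition dist u w := ex_minn (walk_exists u w).

Lemma dist_le u w p : path e u p -> last u p = w -> dist u w <= size p.
Proof.
move=> pp lp; rewrite /dist; case: ex_minnP => n _; apply.
by apply/existsP; exists (in_tuple p); rewrite pp lp eqxx.
Qed.

Lemma dist_path u w : exists2 p, tree_path e u w p & size p = dist u w.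
Proof.
rewrite /dist; case: ex_minnP => n /existsP[p /andP[pp /eqP lp]] min_n.
move: lp; case: (shortenP pp) => q pq uq sqp lq; exists q => //.
have le_qn : size q <= n.
  rewrite -(size_tuple p); apply: uniq_leq_size sqp.
  by case/andP: uq.
apply/eqP; rewrite eqn_leq le_qn min_n //.
by apply/existsP; exists (in_tuple q); rewrite pq lq eqxx.
Qed.

Lemma dist_refl u : dist u u = 0.
Proof. by apply/eqP; rewrite -leqn0; apply: (@dist_le u u [::]). Qed.

Lemma dist_edge u v : e u v -> dist u v <= 1.
Proof. by move=> uv; apply: (@dist_le u v [:: v]) => //=; rewrite uv. Qed.

Lemma dist_gt0 u w : u != w -> 0 < dist u w.
Proof.
have [p [_ _ lp] <-] := dist_path u w.
by apply: contraNltn; case: p lp => [/= ->|].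
Qed.

(** The existential precedes the implication so that [choice] yields a total function. *)
Lemma next_exists f u : exists v, f u != u ->
  [/\ e u v, dist v (f u) < dist u (f u) & route_contains e f (f u) v].
Proof.
have [p tp dp] := dist_path u (f u).
case: p tp dp => [[_ _ /= E] _|v p tp dp]; first by exists u; rewrite -E eqxx.
exists v => _; have [/= /andP[uv vp] _ lp] := tp; split=> //.
  by rewrite -dp ltnS; apply: dist_le.
by exists (v :: p); rewrite pos_perm // !inE eqxx orbT.
Qed.

(* A shove shortens a distance that is at least 2 by one and turns a distance 0
   into 1: the sum of the distances is unchanged, but that of their squares drops. *)
Definition potential f := \sum_w dist w (f w) ^ 2.

Variable rk : V -> nat.
Hypothesis rk_edge : forall u v, e u v -> rk u != rk v.
Hypothesis rk_low :
  forall w u v, e w u -> e w v -> rk u < rk w -> rk v < rk w -> u = v.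

(** Let each misplaced token point to the next vertex of its route. If some token points to a vertex
    whose token is home, a shove applies. Otherwise pointers stay among the vertices with misplaced
    tokens, and two neighbours point at each other. *)
Lemma happy_swap_progress f : ~ sorted_placement f ->
  exists u v, (happy_swap e f u v \/ shove e f u v)
              /\ potential (swap f u v) < potential f.
Proof.
have [_ e_sym _ _ _] := e_tree.
move=> nsort; have [F hF] := choice (next_exists f).
have drop u v := sum_swap (fun w t => dist w t ^ 2) f (u := u) (v := v).
case: (pickP [pred u | (f u != u) && (f (F u) == F u)]) => [u|all_S].
  case/andP=> fu /eqP fF; have [uv du rc] := hF u fu.
  exists u, (F u); split; first by right; split; rewrite // /home pos_perm fF.
  have := drop u (F u) (edge_neq e_tree uv); rewrite fF dist_refl /potential /=.
  have := dist_edge uv; have : 0 < dist (F u) (f u).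
    by apply: dist_gt0; apply: contraTneq (edge_neq e_tree uv) => E; rewrite negbK;
       apply/eqP/(@perm_inj _ f); rewrite fF.
  by nia.
have FS u : f u != u -> f (F u) != F u.
  by move=> fu; have /negbT := all_S u; rewrite /= fu.
have [u0 u0S] : exists u, f u != u.
  apply/existsP; apply: contra_notT nsort => /existsPn fu.
  apply/sorted_placementP/permP=> u; rewrite perm1.
  by apply/eqP; rewrite -[_ == _]negbK.
(* A vertex of least rank among those with misplaced tokens can only point upwards, so [T] below is
   nonempty. *)
have [u1 u1S u1min] : exists2 u, f u != u & forall w, f w != w -> rk u <= rk w.
  by case: (@arg_minnP _ u0 (fun u => f u != u) rk u0S) => u uS um; exists u.
have u1up : rk u1 < rk (F u1).
  have [uF _ _] := hF _ u1S; rewrite ltn_neqAle rk_edge //=.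
  exact/u1min/FS.
pose T := [pred u | (f u != u) && (rk u < rk (F u))].
have u1T : T u1 by rewrite /T /= u1S.
(* If v points to a vertex w of higher rank and rk v is maximal, w points back. *)
case: (@arg_maxnP _ u1 T rk u1T) => v /andP[vS v_up] v_max.
have wS := FS _ vS; have [vw dv rv] := hF v vS; have [wF dw rw] := hF _ wS.
have w_down : rk (F (F v)) < rk (F v).
  rewrite ltn_neqAle eq_sym rk_edge //= leqNgt; apply/negP=> w_up.
  by have := v_max (F v); rewrite /T /= wS w_up => /(_ isT); lia.
have Ew : F (F v) = v by apply: (rk_low wF); rewrite // e_sym.
rewrite Ew in dw rw; exists v, (F v); split; first by left; split.
have := drop v (F v) (edge_neq e_tree vw); rewrite /potential /=.
by nia.
Qed.

Lemma happy_swap_exec_exists f : exists k, happy_swap_exec e f k.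
Proof.
have [n] := ubnP (potential f); elim: n f => // n IH f pf.
have [sf|nsf] := pselect (sorted_placement f); first by exists 0; apply: HappyDone.
have [u [v [op lt]]] := happy_swap_progress nsf.
have [|k ek] := IH (swap f u v); first by lia.
by exists k.+1; apply: HappyStep op ek.
Qed.

End HappySwapTermination.

(** * The double broom *)

Section DoubleBroom.

Variables K N : nat.

(* [inr i] is the i-th vertex of the handle; [inl (j, b)] is the j-th leaf
   attached to its last vertex if [b], to its first vertex otherwise. *)
Local Notation V := ('I_K.+1 * bool + 'I_N.+1)%type.
Implicit Types (u v w t : V) (p : seq V) (f g : {perm V}).

Definition coordinate w : nat :=
  match w with inl (_, b) => if b then N.+2 else 0 | inr i => i.+1 end.

Definition broom : rel V :=
  fun u v => (coordinate u == (coordinate v).+1) || (coordinate v == (coordinate u).+1).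

Definition is_leaf w := if w is inl _ then true else false.

Lemma coord_leq w : coordinate w <= N.+2.
Proof. by case: w => [[j []]|i] //=; have := ltn_ord i; lia. Qed.

Lemma coord_handle_inj u v : 0 < coordinate u < N.+2 -> coordinate u = coordinate v -> u = v.
Proof.
case: u v => [[j []]|i] [[j' []]|i'] //=; rewrite ?ltnn //.
- by have := ltn_ord i; lia.
- by move=> _ [] /val_inj ->.
Qed.

Lemma broom_sym : symmetric broom.
Proof. by move=> u v; rewrite /broom orbC. Qed.

Lemma broom_leaf w : is_leaf w -> leaf broom w.
Proof.
move=> lw a b; rewrite /broom => wa wb; apply: coord_handle_inj;
  have := coord_leq a; have := coord_leq b; move: wa wb;
  by case: w lw => [[j []]|i] //=; lia.
Qed.

(* The leaves at the first handle vertex, the root, have coordinate 0 but depth 1. *)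
Definition broom_rank w := if coordinate w == 0 then 2 else coordinate w.

Lemma broom_rank_edge u v : broom u v -> broom_rank u != broom_rank v.
Proof.
rewrite /broom /broom_rank.
by move: (coordinate u) (coordinate v) => [|a] [|b] /=; lia.
Qed.

Lemma broom_rank_low w u v : broom w u -> broom w v ->
  broom_rank u < broom_rank w -> broom_rank v < broom_rank w -> u = v.
Proof.
have := coord_leq u; have := coord_leq v; have := coord_leq w.
move=> w_le v_le u_le; rewrite /broom /broom_rank => wu wv u_low v_low.
apply: coord_handle_inj; move: w_le v_le u_le wu wv u_low v_low;
  by move: (coordinate w) (coordinate u) (coordinate v) => [|a] [|b] [|c] /=; lia.
Qed.

Lemma broom_walk_to_root u :
  exists p, [/\ path broom u p, last u p = inr ord0 & size p <= N.+1].
Proof.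
(* The leaves of coordinate 0 are one step away from the first handle vertex; any other vertex is
   its coordinate minus one away. *)
suff [p [pp lp sp]] : exists p, [/\ path broom u p, last u p = inr ord0
    & size p <= (coordinate u == 0) + (coordinate u).-1].
  by exists p; split=> //; have := coord_leq u; lia.
move: {2}(coordinate u) (erefl (coordinate u)) => n; elim: n u => [|n IH] u un.
  by exists [:: inr ord0]; split=> //=; rewrite /broom un.
case: n IH un => [|n] IH un.
  by exists [::]; split=> //=; apply: coord_handle_inj; rewrite un.
have cn : coordinate (inr (inord n)) = n.+1.
  by rewrite /= inordK //; have := coord_leq u; lia.
have [p [pp lp sp]] := IH _ cn.
exists (inr (inord n) :: p); split=> //=; first by rewrite pp /broom cn un eqxx.
by rewrite cn in sp; rewrite un; lia.
Qed.

Lemma broom_tree : is_tree broom.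
Proof.
split.
- by apply/card_gt0P; exists (inr ord0).
- exact: broom_sym.
- by move=> u; rewrite /broom; lia.
- have conn u : connect broom u (inr ord0).
    by have [p [pp lp _]] := broom_walk_to_root u; apply/connectP; exists p.
  move=> u v; apply: connect_trans (conn u) _.
  by rewrite (sym_connect_sym broom_sym).
- exact: (acyclic_rank broom_rank_edge broom_sym broom_rank_low).
Qed.

(** Three transpositions with the first handle vertex, each costing at most 2(N + 1). *)
Lemma broom_sortable_tperm u v :
  exists2 m, m <= 6 * N.+1 & sortable_in broom (tperm u v) m.
Proof.
have to_root w : exists2 m, m <= 2 * N.+1 & sortable_in broom (tperm w (inr ord0)) m.
  have [p [pp <- sp]] := broom_walk_to_root w.
  have [m le_m sm] := sortable_tperm_path pp; exists m => //.
  exact: leq_trans le_m (leq_mul (leqnn 2) sp).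
have [m le_m sm] := to_root u; have [n le_n sn] := to_root v.
have [->|vu] := eqVneq v u; first by exists 0 => //; rewrite tperm1; apply: sortable1.
have [->|vr] := eqVneq v (inr ord0); first by exists m => //; lia.
exists (m + (n + m)); first by lia.
have -> : tperm u v = (tperm u (inr ord0) * (tperm v (inr ord0) * tperm u (inr ord0)))%g.
  rewrite -{1}(tpermV u (inr ord0)) -[RHS]/(conjg _ _) tpermJ tpermR.
  by rewrite tpermD 1?eq_sym // tpermC.
by do 2?apply: sortableM.
Qed.

(* A token entering the handle leaves it N + 1 conveyors later (see [conveyors]):
   hence the shift. *)
Definition target w : V :=
  match w with
  | inl (j, true) => inl (j, false)
  | inl (j, false) => inl ((j + inord N.+1)%R, true)
  | inr i => inr i
  end.

Lemma target_inj : injective target.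
Proof.
move=> [[j []]|i] [[j' []]|i'] //= [].
- by move=> ->.
- move=> E; congr (inl (_, _)); apply: (@addIr _ (inord N.+1)); exact: val_inj.
Qed.

Definition placement : {perm V} := perm target_inj.

(** * Upper bound on the optimum *)

Definition chain m i : V :=
  if i == 0 then inl (inord m, false)
  else if i <= N.+1 then inr (inord i.-1) else inl (inord m, true).

Lemma coord_chain m i : i <= N.+2 -> coordinate (chain m i) = i.
Proof.
rewrite /chain; case: i => [//|i] /= iN; case: ifP => /= H; last by lia.
by rewrite inordK //; lia.
Qed.

Lemma chain_handle m m' i : 0 < i <= N.+1 -> chain m i = chain m' i.
Proof. by rewrite /chain; case: i => // i /= ->. Qed.

Lemma chain_inj m : {in [pred i | i <= N.+2] &, injective (chain m)}.
Proof.
by move=> i j iN jN E; rewrite -(coord_chain m iN) E coord_chain.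
Qed.

(* The conveyor m brings the token on right leaf m to left leaf m, the token on
   left leaf m to the handle, and shifts the handle by one step, with the last
   token going to right leaf m. *)
Definition conveyor m := rotation (chain m) N.+2.

Lemma conveyor_chain m i : i < N.+2 -> conveyor m (chain m i) = chain m i.+1.
Proof. by move=> iN; have [H _] := rotation_in (@chain_inj m); apply: H. Qed.

Lemma conveyor_last m : conveyor m (chain m N.+2) = chain m 0.
Proof. by have [_ H] := rotation_in (@chain_inj m). Qed.

Lemma conveyor_leaf m j b : m <= K -> j <= K -> m != j ->
  conveyor m (inl (inord j, b)) = inl (inord j, b).
Proof.
move=> mK jK mj; apply: rotation_out => i _; rewrite /chain.
have neq b' : (inl (inord m, b') : V) != inl (inord j, b).
  by apply: contraNneq mj => -[/(congr1 val)/=]; rewrite !inordK // => ->.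
by case: ifP => // _; case: ifP.
Qed.

Fixpoint conveyors n : {perm V} :=
  if n is m.+1 then (conveyors m * conveyor m)%g else 1%g.

Lemma sortable_conveyors n : sortable_in broom (conveyors n) (n * N.+2).
Proof.
elim: n => [|n IH]; first exact: sortable1.
rewrite mulSnr; apply: sortableM IH _; apply: sortable_rotation => i iN.
by rewrite /broom !coord_chain ?eqxx ?orbT //; lia.
Qed.

Lemma conveyorsS n w : conveyors n.+1 w = conveyor n (conveyors n w).
Proof. by rewrite /= permM. Qed.

Lemma conveyors_before n j b : n <= j -> j <= K ->
  conveyors n (inl (inord j, b)) = inl (inord j, b).
Proof.
elim: n => [|n IH] nj jK; first by rewrite perm1.
by rewrite conveyorsS IH ?conveyor_leaf //; lia.
Qed.

Lemma conveyors_right n j : j < n -> n <= K.+1 ->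
  conveyors n (inl (inord j, true)) = inl (inord j, false).
Proof.
elim: n => // n IH; rewrite ltnS leq_eqVlt => /predU1P[->|jn] nK.
  rewrite conveyorsS conveyors_before //.
  by have := conveyor_last n; rewrite /chain /= ltnn.
by rewrite conveyorsS IH ?conveyor_leaf //; lia.
Qed.

Lemma conveyors_handle j d : d <= N.+1 -> j + d <= K.+1 -> j <= K ->
  conveyors (j + d) (chain j 0) = chain j d.
Proof.
elim: d => [|d IH] dN jd jK; first by rewrite addn0 conveyors_before.
rewrite addnS conveyorsS IH //; try lia.
(* All chains share the handle, so the token lies on the chain that the next conveyor rotates. *)
have -> : chain j d = chain (j + d) d.
  by case: d {IH} dN jd => [|d] dN jd; rewrite ?addn0 //; apply: chain_handle; lia.
by rewrite conveyor_chain; [apply: chain_handle|]; lia.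
Qed.

Lemma conveyors_left n j : j + N.+1 < n -> n <= K.+1 ->
  conveyors n (inl (inord j, false)) = inl (inord (j + N.+1), true).
Proof.
elim: n => // n IH; rewrite ltnS leq_eqVlt => /predU1P[<-|jn] nK.
  rewrite conveyorsS -[inl (inord j, _)]/(chain j 0) conveyors_handle //; try lia.
  rewrite (chain_handle _ (j + N.+1)) //; last by lia.
  by rewrite conveyor_chain // /chain /= ltnn.
by rewrite conveyorsS IH ?conveyor_leaf //; lia.
Qed.

(** The two can differ only on the handle and on the last N + 1 left leaves, whose tokens are still
    on the handle when the conveyors stop. For the other left leaves the shift in [target] does not
    wrap around. *)
Lemma placement_conveyors : N < K ->
  #|[set w | placement w != conveyors K.+1 w]| <= 2 * N.+1.
Proof.
move=> NK; pose last_left (i : 'I_N.+1) : V := inl (inord (K - i), false).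
apply: (@leq_trans #|[set inr i | i : 'I_N.+1] :|: [set last_left i | i : 'I_N.+1]|).
  apply: subset_leq_card; apply/subsetP=> w; rewrite !inE permE.
  case: w => [[j []]|i] /=; last by rewrite imset_f.
    have := @conveyors_right K.+1 j (ltn_ord j) (leqnn _).
    by rewrite inord_val => ->; rewrite eqxx.
  have [jN|jN] := ltnP (j + N.+1) K.+1.
    have := @conveyors_left K.+1 j jN (leqnn _).
    rewrite inord_val => ->; case/eqP; congr (inl (_, _)); apply: val_inj => /=.
    by rewrite !inordK ?modn_small //; lia.
  move=> _; apply/orP; right; apply/imsetP; exists (inord (K - j)) => //.
  have := ltn_ord j => jK; rewrite /last_left inordK; last by lia.
  by congr (inl (_, _)); apply: val_inj; rewrite /= inordK; lia.
apply: (leq_trans (leq_card_setU _ _)); rewrite mul2n -addnn.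
by apply: leq_add; apply: (leq_trans (leq_imset_card _ _)); rewrite card_ord.
Qed.

Lemma sortable_placement : N < K ->
  exists2 m, m <= K.+1 * N.+2 + 2 * N.+1 * (6 * N.+1)
           & sortable_in broom placement m.
Proof.
move=> /placement_conveyors H.
exact: sortable_patch broom_sortable_tperm H (sortable_conveyors _).
Qed.

End DoubleBroom.

Arguments is_leaf {K N} w.

(** * Lower bounds on the double broom *)

Section LowerBounds.

Variables K N : nat.
Local Notation V := ('I_K.+1 * bool + 'I_N.+1)%type.
Local Notation broom := (@broom K N).
Local Notation placement := (placement K N).
Implicit Types (u v w t : V) (p c : seq V) (cs : seq (seq V)) (f g : {perm V}).

(* Leaves are projected to the handle: only swaps inside it change levels. *)
Definition level w := minn (coordinate w).-1 N.

Lemma is_leaf_placement w : is_leaf (placement w) = is_leaf w.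
Proof. by rewrite permE; case: w => [[j []]|i]. Qed.

Lemma level_placement w : is_leaf w ->
  level w = 0 /\ level (placement w) = N \/ level w = N /\ level (placement w) = 0.
Proof. by rewrite permE /level; case: w => [[j []]|i] //= _; lia. Qed.

Lemma level_edge u v : broom u v -> level u <= (level v).+1.
Proof. by rewrite /broom /level; lia. Qed.

Lemma level_path u p : path broom u p ->
  level u <= level (last u p) + size p /\ level (last u p) <= level u + size p.
Proof.
elim: p u => [|x p IH] u /=; first by lia.
case/andP=> ux /IH[]; have := level_edge ux; rewrite broom_sym in ux.
have := level_edge ux; lia.
Qed.

Lemma placement_path_size w p : is_leaf w ->
    tree_path broom w (placement w) p \/ tree_path broom (placement w) w p ->
  N <= size p.
Proof.
move=> /level_placement lw [] [/level_path pp _ E]; rewrite E in pp; lia.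
Qed.

(** * Lower bound for the Cycle algorithm *)

(** Each token starts at a leaf opposite to its destination, so its full path has at least N edges,
    of which at most the last is left out. *)
Lemma process_cycle_cost f c g k : process_cycle broom f c g k ->
    uniq c -> all is_leaf c -> sorted (frel placement) c ->
    {in c, forall t, pos f t = pos placement t} ->
  N.-1 * size c <= k.
Proof.
have sym := @broom_sym K N.
elim=> {f c g k} [f t p|f t t' s p g k] tp.
  rewrite /= andbT muln1 => _ lt _ /(_ t (mem_head _ _)) pt.
  apply: leq_trans (leq_pred N) _.
  apply: (@placement_path_size (pos placement t)); first
    by rewrite -is_leaf_placement posK.
  by left; rewrite posK -pt.
move=> _ IH /andP[tc uc] /andP[lt lc] /= /andP[/eqP tt' sc] pc.
have pt := pc t (mem_head _ _); have pt' : pos f t' = t.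
  by rewrite pc ?inE ?eqxx ?orbT // -tt' pos_perm.
have sp : N <= size (rcons p t).
  apply: (@placement_path_size (pos placement t)); first
    by rewrite -is_leaf_placement posK.
  by left; move: tp; rewrite posK pt pt'.
rewrite /= mulnS; apply: leq_add.
  by rewrite size_rcons in sp; rewrite -subn1 leq_subLR.
apply: IH => // x xc; have px : pos f x = pos placement x.
  by apply: pc; rewrite inE xc orbT.
rewrite -px; apply: (@perm_inj _ (move_along f (pos f t) p)).
rewrite posK move_along_out ?posK //; apply/negP => xp.
have lx : is_leaf (pos f x) by rewrite px -is_leaf_placement posK; exact: (allP (lc : all is_leaf (t' :: s))).
(* The leaf of [x] could only be an end of the full path, but the start carries [t] and the other
   end is not in [p]. *)
have [_ up _] := tp; case: (leaf_end_of_path sym (broom_leaf lx) tp).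
- by rewrite -rcons_cons mem_rcons inE xp orbT.
- by move/perm_inj=> xt; rewrite -xt xc in tc.
- by move=> E; move: up; rewrite -rcons_cons rcons_uniq -E xp.
Qed.

Lemma fpath_leaf w p : fpath placement w p ->
  {in w :: p, forall y, is_leaf y = is_leaf w}.
Proof.
elim: p w => [|x p IH] w /=; first by move=> _ y; rewrite inE => /eqP->.
case/andP=> /eqP wx /IH xp y; rewrite inE => /predU1P[->//|/xp->].
by rewrite -wx is_leaf_placement.
Qed.

(** As [placement] maps leaves to leaves, a cycle has only leaf tokens or none. Processing it leaves
    the leaf tokens of later cycles in place. *)
Lemma process_cycles_cost f cs g k : process_cycles broom f cs g k ->
    [::] \notin cs -> all (fcycle placement) cs -> uniq (flatten cs) ->
    {in flatten cs, forall t, is_leaf t -> pos f t = pos placement t} ->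
  N.-1 * count is_leaf (flatten cs) <= k.
Proof.
elim=> {f cs g k} [f|f c cs g h k l fc _ IH]; first by rewrite muln0.
rewrite inE negb_or /= => /andP[c0 cs0] /andP[cc ccs].
rewrite cat_uniq => /and3P[uc /hasPn ucs ufl] pc.
rewrite count_cat mulnDr; apply: leq_add.
  case: c c0 cc uc fc {ucs} pc => [//|x s] _ cc uc fc pc.
  have /fpath_leaf lxs : fpath placement x s.
    by move: cc; rewrite /= rcons_path => /andP[].
  case lx: (is_leaf x); last first.
    suff /eqP-> : count is_leaf (x :: s) == 0 by rewrite muln0.
    by rewrite -leqn0 leqNgt -has_count -all_predC; apply/allP=> y /lxs /=; rewrite lx => ->.
  have lc : all is_leaf (x :: s) by apply/allP=> y /lxs; rewrite lx.
  have /eqP-> : count is_leaf (x :: s) == size (x :: s) by rewrite -all_count.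
  apply: (process_cycle_cost fc uc lc).
    by move: cc; rewrite /= rcons_path => /andP[].
  by move=> t tc; apply: pc; rewrite ?mem_cat ?tc //; apply: (allP lc).
apply: IH => // t tcs lt; have tc := ucs t tcs.
have pt := pc t; rewrite mem_cat tcs orbT in pt; have {}pt := pt isT lt.
rewrite -pt; apply: (@perm_inj _ g); rewrite posK.
have lw : is_leaf (pos f t) by rewrite pt -is_leaf_placement posK.
rewrite (process_cycle_leaf (broom_tree K N) fc (broom_leaf lw)) ?posK //.
(* If the starting vertex of [t] were in [c], so would be its successor in the cycle, which is
   [t]. *)
apply: contra tc; rewrite pt => wc.
rewrite -[X in X \in _](posK placement t) (eqP (next_cycle cc wc)).
by rewrite mem_next.
Qed.

(** * Lower bound for the Happy Swap algorithm *)

Definition to_left t := if t is inl (_, false) then true else false.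
Definition to_right t := if t is inl (_, true) then true else false.

Definition remaining w t :=
  if to_left t then level w else if to_right t then N - level w else 0.

Definition total_remaining f := \sum_w remaining w (f w).

(** The credit in the amortised count: two leaf tokens on the handle still have to pass each
    other. *)
Definition facing_pair f := [exists a : 'I_N.+1, exists b : 'I_N.+1,
  [&& a < b, to_right (f (inr a)) & to_left (f (inr b))]].

(* Each handle token off the handle is next to its home, which is then one of
   the two ends of the handle. *)
Lemma leaf_tokens_on_handle f : (forall i, near_home broom f (inr i)) ->
  #|[set i : 'I_N.+1 | is_leaf (f (inr i))]| <= 2.
Proof.
move=> nf; pose H := [set w : V | ~~ is_leaf w].
(* As many leaf tokens are on the handle as handle tokens are off it. *)
have cH : #|f @^-1: H| = #|H| by apply: card_preimset; apply: perm_inj.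
have c1 := cardsID (f @^-1: H) H; have c2 := cardsID H (f @^-1: H).
have -> : #|[set i : 'I_N.+1 | is_leaf (f (inr i))]| = #|H :\: f @^-1: H|.
  rewrite -(card_imset _ (@inr_inj ('I_K.+1 * bool) 'I_N.+1)).
  apply: eq_card => w; rewrite !inE negbK; apply/idP/idP.
    by case/imsetP=> i; rewrite inE => fi ->; rewrite fi.
  by case: w => [q|i] /andP[fi] //= _; rewrite imset_f ?inE.
have -> : #|H :\: f @^-1: H| = #|f @^-1: H :\: H|.
  by apply: (@addnI #|H :&: f @^-1: H|); rewrite c1 setIC c2 cH.
rewrite -(card_imset _ (@perm_inj _ f)).
apply: (@leq_trans #|[set inr ord0; inr ord_max : V]|); last by rewrite cards2; case: eqP.
apply: subset_leq_card; apply/subsetP=> _ /imsetP[w + ->].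
rewrite !inE negbK => /andP[lw fw].
case E: (f w) fw => [//|i] _; have := nf i; rewrite -E /near_home /home pos_perm E.
case=> [wi|]; first by rewrite wi in lw.
case: w lw {E} => [[j []]|//] _ /=; rewrite /broom /=.
  move=> H1; apply/orP; right; apply/eqP; congr inr; apply: val_inj => /=.
  by have := ltn_ord i; lia.
by move=> H1; apply/orP; left; apply/eqP; congr inr; apply: val_inj => /=; lia.
Qed.

(* Two leaf tokens that cross inside the handle gain 2, but end the only facing
   pair. *)
Lemma total_remaining_swap f u v : (forall i, near_home broom f (inr i)) ->
    broom u v ->
  total_remaining f + facing_pair (swap f u v) <=
    (total_remaining (swap f u v) + facing_pair f).+1.
Proof.
move=> nf; wlog cuv : u v / coordinate v = (coordinate u).+1.
  move=> W uv; case/orP: (uv) => /eqP E; last exact: W.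
  by rewrite swapC; apply: W => //; rewrite broom_sym.
move=> uv; have := sum_swap remaining f (edge_neq (broom_tree K N) uv).
rewrite -!/(total_remaining _); set T := total_remaining f; set T' := total_remaining _.
have A1 : facing_pair (swap f u v) <= 1 by case: facing_pair.
have cv := coord_leq v.
case: u v cuv uv cv T' A1 => [[x []]|i] [[y []]|j] /= cuv uv cv T' A1; try by lia.
(* A swap at a leaf changes no level, so the total is unchanged; at worst a facing pair disappears
   or appears, a change of at most 1. *)
- by rewrite /remaining /level /=; do 4?case: ifP; lia.
- by rewrite /remaining /level /=; do 4?case: ifP; lia.
have ij : (j : nat) = i.+1 by case: cuv.
have iN := ltn_ord i; have jN := ltn_ord j.
have li : level (inr i : V) = i by rewrite /level /=; lia.
have lj : level (inr j : V) = i.+1 by rewrite /level /=; lia.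
have swap_handle a : swap f (inr i) (inr j) (inr a) = f (inr (tperm i j a)).
  by rewrite swapE (inj_tperm _ _ _ inr_inj).
have facing_mono : ~~ (to_right (f (inr j)) && to_left (f (inr i))) ->
    facing_pair (swap f (inr i) (inr j)) <= facing_pair f.
  move=> nij; suff: facing_pair (swap f (inr i) (inr j)) -> facing_pair f.
    by case: facing_pair => // /(_ isT) ->.
  case/existsP=> a /existsP[b /and3P[ab]]; rewrite !swap_handle => ra lb.
  apply/existsP; exists (tperm i j a); apply/existsP; exists (tperm i j b).
  have neq (x y : 'I_N.+1) : x <> y -> (x : nat) <> y by move=> xy /val_inj.
  rewrite ra lb !andbT; case: tpermP ra => [ai|aj|/neq ai /neq aj] ra;
    case: tpermP lb => [bi|bj|/neq bi /neq bj] lb; subst; try lia.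
  by rewrite ra lb in nij.
have crossing : to_right (f (inr i)) -> to_left (f (inr j)) ->
    facing_pair f /\ ~~ facing_pair (swap f (inr i) (inr j)).
  move=> ri lj'; split.
    by apply/existsP; exists i; apply/existsP; exists j; rewrite ri lj' ij ltnSn.
  apply/existsP=> -[a /existsP[b /and3P[ab]]]; rewrite !swap_handle => ra lb.
  (* With at most two leaf tokens on the handle, [i] and [j] carry them all, and after the swap
     these two head away from each other. *)
  have S2 := leaf_tokens_on_handle nf; set S := [set _ | _] in S2.
  have leafS x : to_left (f (inr x)) || to_right (f (inr x)) -> x \in S.
    by rewrite inE; case: (f (inr x)).
  have defS : [set i; j] = S.
    apply/eqP; rewrite eqEcard cards2 subUset !sub1set !leafS ?ri ?lj' ?orbT //=.
    by have -> : i != j by apply/eqP=> E; rewrite E in ij; lia.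
  have aS : tperm i j a \in S by rewrite leafS ?ra ?orbT.
  have bS : tperm i j b \in S by rewrite leafS ?lb.
  move: aS bS; rewrite -defS !inE => /orP[]/eqP ta /orP[]/eqP tb; rewrite ?ta ?tb in ra lb.
  - by move: lb ri; case: (f _) => [[? []]|].
  - have := congr1 (tperm i j) ta; have := congr1 (tperm i j) tb.
    by rewrite !tpermK tpermL tpermR => bi aj; rewrite bi aj in ab; lia.
  - by move: lb ri; case: (f _) => [[? []]|].
  - by move: ra lj'; case: (f _) => [[? []]|].
rewrite /remaining li lj.
have excl t : ~~ (to_left t && to_right t) by case: t => [[? []]|].
have := excl (f (inr i)); have := excl (f (inr j)).
case: (boolP (to_right (f (inr i)) && to_left (f (inr j)))) => [/andP[ri lj']|].
  have [-> /negbTE->] := crossing ri lj'; rewrite ri lj' /= andbT => _ /negbTE->.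
  by lia.
(* Both tokens move away from their destinations: the total grows by 2, which covers a new facing
   pair. *)
case: (boolP (to_right (f (inr j)) && to_left (f (inr i)))) => [/andP[rj li']|].
  by rewrite rj li' /= andbT => _ /negbTE-> _; lia.
move=> /facing_mono; move: (to_left (f (inr i))) (to_left (f (inr j))).
move: (to_right (f (inr i))) (to_right (f (inr j))).
by move=> [] [] [] [] //=; lia.
Qed.

(** Each swap lowers [total_remaining - facing_pair] by at most 1, and the total is 0 once the
    tokens are sorted. *)
Lemma happy_swap_exec_cost f k : happy_swap_exec broom f k ->
  (forall i, near_home broom f (inr i)) -> total_remaining f <= k + facing_pair f.
Proof.
elim=> {f k} [f /sorted_placementP-> _|f u v k _ op _ IH nf].
  rewrite /total_remaining big1 // => -[[j []]|i] _; rewrite perm1 /remaining /level //=; lia.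
have uv : broom u v by case: op => -[].
have H := IH (fun i => near_home_step (broom_tree K N) op (nf i)).
rewrite -(leq_add2r (facing_pair (swap f u v))).
apply: leq_trans (total_remaining_swap nf uv) _.
by rewrite !addSn ltnS addnAC leq_add2r.
Qed.

Lemma happy_swap_cost k : happy_swap_exec broom placement k -> 2 * K.+1 * N <= k.
Proof.
have ph i : placement (inr i) = inr i by rewrite permE.
move/happy_swap_exec_cost => H; have {H} := H _.
have -> : facing_pair placement = false.
  by apply/existsP=> -[a /existsP[b]]; rewrite ph andbF.
have -> : total_remaining placement = 2 * K.+1 * N.
  rewrite /total_remaining big_sumType /= [X in _ + X]big1 ?addn0; last first.
    by move=> i _; rewrite ph.
  rewrite (eq_bigr (fun=> N)); last first.
    by move=> [j []] _; rewrite permE /remaining /level /=; lia.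
  by rewrite sum_nat_const card_prod card_ord card_bool; lia.
rewrite addn0; apply=> i; left.
by rewrite /home -{1}ph pos_perm.
Qed.

Lemma cycle_cost k : cycle_exec broom placement k -> 2 * K.+1 * N.-1 <= k.
Proof.
case=> cs [g [[cs0 csc csp] pcs]].
have := process_cycles_cost pcs cs0 csc; rewrite (perm_uniq csp) enum_uniq.
move=> /(_ isT (fun _ _ _ => erefl)); rewrite (seq.permP csp).
suff -> : count is_leaf (enum {: V}) = 2 * K.+1 by rewrite mulnC.
rewrite -sum1_count big_enum_cond big_mkcond big_sumType /= sum_nat_const.
by rewrite sum_nat_const card_prod card_bool card_ord; lia.
Qed.

End LowerBounds.

(** * Choice of parameters and the ratio of costs *)

Lemma double_broom_instance N : 1 < N ->
  exists (V : finType) (e : rel V) (f : {perm V}) (opt M : nat),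
    [/\ is_tree e, is_OPT e f opt, 0 < M /\ opt <= M * (N + 3),
        (exists k, happy_swap_exec e f k) /\ (exists k, cycle_exec e f k)
      & forall k, happy_swap_exec e f k \/ cycle_exec e f k -> M * (2 * (N - 1)) <= k].
Proof.
(* [K] equals the patching cost, which thus amounts to less than one swap per conveyor: (K + 1)(N +
   2) + K is at most (K + 1)(N + 3). *)
move=> N1; pose K := 2 * N.+1 * (6 * N.+1).
have [m le_m sm] : exists2 m, m <= K.+1 * N.+2 + 2 * N.+1 * (6 * N.+1)
    & sortable_in (@broom K N) (placement K N) m.
  by apply: sortable_placement; rewrite /K; nia.
have [opt le_opt optP] := is_OPT_exists sm.
have tree := broom_tree K N.
exists _, (@broom K N), (placement K N), opt, K.+1; split=> //.
- by split=> //; apply: leq_trans le_opt (leq_trans le_m _); rewrite -/K; nia.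
- split; last exact: cycle_exec_exists.
  exact: (happy_swap_exec_exists tree (@broom_rank_edge K N) (@broom_rank_low K N)).
- move=> k [/happy_swap_cost|/cycle_cost]; nia.
Qed.

Local Open Scope ring_scope.

Theorem theorem4p2 (R : realType) :
  (forall eps : R, 0 < eps ->
     exists (V : finType) (e : rel V) (f : {perm V}) (opt : nat),
       [/\ is_tree e, is_OPT e f opt,
           forall k : nat, happy_swap_exec e f k ->
             (2 - eps) * opt%:R < k%:R
         & forall k : nat, cycle_exec e f k ->
             (2 - eps) * opt%:R < k%:R])
  /\ (forall c : R, c < 2 ->
        ~ approximation_factor (@happy_swap_exec) c
        /\ ~ approximation_factor (@cycle_exec) c).
Proof.
have instance (eps : R) : 0 < eps ->
    exists (V : finType) (e : rel V) (f : {perm V}) (opt : nat),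
      [/\ is_tree e, is_OPT e f opt,
          (exists k, happy_swap_exec e f k) /\ (exists k, cycle_exec e f k)
        & forall k, happy_swap_exec e f k \/ cycle_exec e f k ->
            (2 - eps) * opt%:R < k%:R].
  (* With N = n + 2 the goal reduces to (2 - eps)(n + 5) < 2(n + 1), that is, 8 < eps (n + 5). *)
  move=> eps0; pose n := Num.bound (8 / eps).
  have n_eps : 8 < eps * n%:R.
    by rewrite mulrC -ltr_pdivrMr //; apply: archi_boundP; apply: divr_ge0 => //; exact: ltW.
  have [|V [e [f [opt [M [tree optP [M0 le_opt] ex lb]]]]]] := @double_broom_instance n.+2.
    by [].
  exists V, e, f, opt; split=> // k /lb; rewrite -(ler_nat R); apply: lt_le_trans.
  have M1 : 0 < M%:R :> R by rewrite ltr0n.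
  have {}le_opt : opt%:R <= M%:R * (n%:R + 5) :> R.
    by rewrite -(natrD _ n 5) -natrM ler_nat; apply: leq_trans le_opt _; lia.
  have -> : (M * (2 * (n.+2 - 1)))%:R = M%:R * (2 * (n%:R + 1)) :> R.
    by rewrite !natrM natr1; congr (_ * (_ * _%:R)); lia.
  have opt0 : 0 <= opt%:R :> R by [].
  have n0 : 0 <= n%:R :> R by [].
  (* For eps at least 2 the left side is not positive; otherwise 2 - eps is positive and the bound
     on [opt] can be multiplied by it. *)
  have [eps2|eps2] := lerP 2 eps.
    apply: (@le_lt_trans _ _ 0); first by apply: mulr_le0_ge0 => //; lra.
    by apply: mulr_gt0 => //; lra.
  apply: (@le_lt_trans _ _ ((2 - eps) * (M%:R * (n%:R + 5)))).
    by apply: ler_wpM2l => //; lra.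
  by rewrite mulrCA ltr_pM2l //; lra.
split=> [eps /instance[V [e [f [opt [tree optP _ lb]]]]]|c c2].
  by exists V, e, f, opt; split=> // k ek; apply: lb; [left|right].
have [|V [e [f [opt [tree optP [[k hk] [l cl]] lb]]]]] := instance (2 - c).
  by rewrite subr_gt0.
rewrite subKr in lb.
split=> appr; [have le := appr _ _ _ _ _ tree optP hk | have le := appr _ _ _ _ _ tree optP cl].
  by have := lb k (or_introl hk); rewrite ltNge le.
by have := lb l (or_intror cl); rewrite ltNge le.
Qed.
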